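(* Let $K\subset\mathbb{R}^n$ be a proper convex cone, $\psi$ an upper semi-continuous concave function on $K$ that is non-decreasing with respect to $\le_K$ and satisfies $\psi(0)=0$, and suppose $\psi$ satisfies Assumption 1 (see context). For $t\in[m]$ let $F_t\subset\mathbb{R}^k$ be compact convex sets and $A_t\in\mathbb{R}^{n\times k}$ with $A_tF_t\subset K$, and let $D^\star$ be the optimal value of the dual problem. Then for the simultaneous update algorithm $$P_{\rm sim}\ge\frac{1}{1-\bar\alpha_\psi}D^\star,$$ and for the sequential update algorithm $$P_{\rm seq}\ge\frac{1}{1-\bar\alpha_\psi}\Big(D^\star+\sum_{t=1}^m\langle A_t\hat x_t,\hat y_{t+1}-\hat y_t\rangle\Big).$$ Further, if $\psi$ is differentiable with gradient Lipschitz continuity parameter $1/\mu$ with respect to a norm $\|\cdot\|$, then $$P_{\rm seq}\ge\frac{1}{1-\bar\alpha_\psi}\Big(D^\star-\sum_{t=1}^m\frac{1}{2\mu}\|A_t\hat x_t\|^2\Big).$$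
   Context: $\psi$ is extended by $-\infty$ outside $K$; $\psi^*(y)=\inf_u\langle y,u\rangle-\psi(u)$ (concave conjugate); $\partial\psi(u)=\{y:\psi(u')\le\langle y,u'-u\rangle+\psi(u)\ \forall u'\}$ (superdifferential), assumed nonempty on $K$. $K^*=\{y:\langle y,u\rangle\ge0\ \forall u\in K\}$; $x\le_K y$ iff $y-x\in K$, $x\le_{K^*}y$ iff $y-x\in K^*$. $\sigma_t(z)=\sup_{x\in F_t}\langle x,z\rangle$. Offline primal: maximize $\psi(\sum_tA_tx_t)$ over $x_t\in F_t$; dual: minimize over $y$ the function $\sum_t\sigma_t(A_t^Ty)-\psi^*(y)$, with optimal value $D^\star$. Assumption 1: whenever $u\ge_K v$, there exists $y\in\partial\psi(u)$ with $y\le_{K^*}z$ for all $z\in\partial\psi(v)$. $\alpha_\psi(u)=\sup\{c:\psi^*(y)\ge c\,\psi(u)\ \forall y\in\partial\psi(u)\}$ and $\bar\alpha_\psi=\inf\{\alpha_\psi(u):u\in K\}$. Sequential update algorithm: $\hat y_1\in\partial\psi(0)$; for $t=1,\dots,m$: $\hat x_t\in\arg\max_{x\in F_t}\langle x,A_t^T\hat y_t\rangle$, $\hat y_{t+1}\in\partial\psi(\sum_{s\le t}A_s\hat x_s)$, where $\hat y_{m+1}$ is taken to be the least element of $\partial\psi(\sum_{s\le m}A_s\hat x_s)$ w.r.t. $\le_{K^*}$. Simultaneous update algorithm: for each $t$, $(\tilde y_t,\tilde x_t)\in\arg\min_y\max_{x\in F_t}\langle y,A_tx+\sum_{s<t}A_s\tilde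 x_s\rangle-\psi^*(y)$. $P_{\rm seq}=\psi(\sum_tA_t\hat x_t)$, $P_{\rm sim}=\psi(\sum_tA_t\tilde x_t)$. Lipschitz gradient means $\|\nabla\psi(u')-\nabla\psi(u)\|_*\le\frac1\mu\|u-u'\|$ with $\|\cdot\|_*$ the dual norm.
   Formalization: In the last bound each ŷ_t (t ≤ m) is required to be ∇ψ(Σ_{s<t}A_s x̂_s); with arbitrary supergradients at boundary points of K it fails. The simultaneous step is read as a saddle point, and 1/(1−ᾱ_ψ) as 0 when ψ vanishes on K. *)

(* Defs.v *)
From HB Require Import structures.
From mathcomp Require Import all_boot all_order all_algebra.
From mathcomp Require Import boolp classical_sets functions interval_inference.
From mathcomp Require Import reals ereal topology normedtype convex.

Set Implicit Arguments.
Unset Strict Implicit.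
Unset Printing Implicit Defensive.

Import Order.TTheory GRing.Theory Num.Theory.
Import numFieldNormedType.Exports.

Local Open Scope classical_set_scope.
Local Open Scope ring_scope.

Definition dot (R : realType) (n : nat) (u v : 'cV[R]_n) : R :=
  \sum_(i < n) u i ord0 * v i ord0.

Definition proper_cone (R : realType) (n : nat) (K : set 'cV[R]_n) : Prop :=
  [/\ K 0 /\ (forall (c : R) u, 0 <= c -> K u -> K (c *: u)),
      convex_set K,
      closed K,
      (forall u, K u -> K (- u) -> u = 0) &
      K° !=set0].

Definition dual_cone (R : realType) (n : nat) (K : set 'cV[R]_n) :
    set 'cV[R]_n :=
  [set y | forall u, K u -> 0 <= dot y u].

Definition cone_le (R : realType) (n : nat) (K : set 'cV[R]_n)
    (x y : 'cV[R]_n) : Prop := K (y - x).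

Definition nondecreasing_on (R : realType) (n : nat) (K : set 'cV[R]_n)
    (psi : 'cV[R]_n -> R) : Prop :=
  forall u v, K u -> K v -> cone_le K u v -> psi u <= psi v.

Definition concave_on (R : realType) (n : nat) (K : set 'cV[R]_n)
    (psi : 'cV[R]_n -> R) : Prop :=
  convex_function K (fun u => - psi u).

(* Mirror image of the library's lower_semicontinuous. *)
Definition upper_semicontinuous (R : realType) (X : topologicalType)
    (f : X -> \bar R) : Prop :=
  forall x a, (f x < a%:E)%E ->
    exists2 V, nbhs x V & forall y, V y -> (f y < a%:E)%E.

(* Only the values of psi on K are meaningful. *)
Definition ext (R : realType) (n : nat) (K : set 'cV[R]_n)
    (psi : 'cV[R]_n -> R) (u : 'cV[R]_n) : \bar R :=
  if u \in K then (psi u)%:E else -oo%E.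

Definition conjugate (R : realType) (n : nat) (K : set 'cV[R]_n)
    (psi : 'cV[R]_n -> R) (y : 'cV[R]_n) : \bar R :=
  ereal_inf [set ((dot y u)%:E - ext K psi u)%E | u in [set: 'cV[R]_n]].

Definition superdiff (R : realType) (n : nat) (K : set 'cV[R]_n)
    (psi : 'cV[R]_n -> R) (u : 'cV[R]_n) : set 'cV[R]_n :=
  [set y | forall u',
     (ext K psi u' <= (dot y (u' - u))%:E + ext K psi u)%E].

Definition assumption1 (R : realType) (n : nat) (K : set 'cV[R]_n)
    (psi : 'cV[R]_n -> R) : Prop :=
  forall u v, K u -> K v -> cone_le K v u ->
    exists2 y, superdiff K psi u y &
      forall z, superdiff K psi v z -> cone_le (dual_cone K) y z.

Definition alpha (R : realType) (n : nat) (K : set 'cV[R]_n)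
    (psi : 'cV[R]_n -> R) (u : 'cV[R]_n) : \bar R :=
  ereal_sup [set c%:E | c in
    [set c : R | forall y, superdiff K psi u y ->
                   ((c * psi u)%:E <= conjugate K psi y)%E]].

Definition alpha_bar (R : realType) (n : nat) (K : set 'cV[R]_n)
    (psi : 'cV[R]_n -> R) : \bar R :=
  ereal_inf [set alpha K psi u | u in K].

(* 1 / (1 - a), with 1 / (1 - a) = 0 when a is infinite.  The division of
   extended reals is not used because it sets (-oo)^-1 = -oo, and
   alpha_bar = +oo does occur: alpha u = +oo as soon as psi u = 0, so
   alpha_bar = +oo when psi vanishes on K.  Otherwise alpha_bar is a real
   number in [-1, 0]. *)
Definition inv_one_minus (R : realType) (a : \bar R) : \bar R :=
  if a is r%:E then ((1 - r)^-1)%:E else 0%E.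

Definition support_fun (R : realType) (k : nat) (F : set 'cV[R]_k)
    (z : 'cV[R]_k) : \bar R :=
  ereal_sup [set (dot x z)%:E | x in F].

Definition dual_objective (R : realType) (n k m : nat) (K : set 'cV[R]_n)
    (psi : 'cV[R]_n -> R) (F : 'I_m -> set 'cV[R]_k)
    (A : 'I_m -> 'M[R]_(n, k)) (y : 'cV[R]_n) : \bar R :=
  (\sum_(t < m) support_fun (F t) ((A t)^T *m y)%R - conjugate K psi y)%E.

Definition dual_value (R : realType) (n k m : nat) (K : set 'cV[R]_n)
    (psi : 'cV[R]_n -> R) (F : 'I_m -> set 'cV[R]_k)
    (A : 'I_m -> 'M[R]_(n, k)) : \bar R :=
  ereal_inf [set dual_objective K psi F A y | y in [set: 'cV[R]_n]].

(* Steps are numbered from 0: step t : 'I_m is the (t+1)-st one, and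
   partial_load A x j is the sum of A s *m x s over the first j steps. *)
Definition partial_load (R : realType) (n k m : nat)
    (A : 'I_m -> 'M[R]_(n, k)) (x : 'I_m -> 'cV[R]_k) (j : nat) : 'cV[R]_n :=
  \sum_(s < m | (s < j)%N) A s *m x s.

Definition arg_max (R : realType) (T : Type) (F : set T) (f : T -> R) : set T :=
  [set x | F x /\ forall x', F x' -> f x' <= f x].

(* Here yhat t is the dual variable used at step t, for t < m, and yhat m is
   the final one (the 1-based indices 1, ..., m and m+1); the values of yhat
   beyond m are irrelevant. *)
Definition sequential_run (R : realType) (n k m : nat) (K : set 'cV[R]_n)
    (psi : 'cV[R]_n -> R) (F : 'I_m -> set 'cV[R]_k)
    (A : 'I_m -> 'M[R]_(n, k))
    (xhat : 'I_m -> 'cV[R]_k) (yhat : nat -> 'cV[R]_n) : Prop :=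
  [/\ superdiff K psi 0 (yhat 0%N),
      (forall t : 'I_m,
         arg_max (F t) (fun x => dot x ((A t)^T *m yhat t)) (xhat t)),
      (forall t : 'I_m,
         superdiff K psi (partial_load A xhat t.+1) (yhat t.+1)) &
      (forall z, superdiff K psi (partial_load A xhat m) z ->
         cone_le (dual_cone K) (yhat m) z)].

Definition saddle_objective (R : realType) (n k : nat) (K : set 'cV[R]_n)
    (psi : 'cV[R]_n -> R) (A : 'M[R]_(n, k)) (u : 'cV[R]_n)
    (y : 'cV[R]_n) (x : 'cV[R]_k) : \bar R :=
  ((dot y (A *m x + u))%:E - conjugate K psi y)%E.

(* (y, x) solves min_y max_(x in F) L y x jointly, i.e. is a saddle point. *)
Definition arg_min_max (R : realType) (S T : Type) (F : set T)
    (L : S -> T -> \bar R) (y : S) (x : T) : Prop :=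
  [/\ F x,
      (forall x', F x' -> (L y x' <= L y x)%E) &
      (forall y', (L y x <= L y' x)%E)].

Definition simultaneous_run (R : realType) (n k m : nat) (K : set 'cV[R]_n)
    (psi : 'cV[R]_n -> R) (F : 'I_m -> set 'cV[R]_k)
    (A : 'I_m -> 'M[R]_(n, k))
    (xtil : 'I_m -> 'cV[R]_k) (ytil : 'I_m -> 'cV[R]_n) : Prop :=
  forall t : 'I_m,
    arg_min_max (F t)
      (saddle_objective K psi (A t) (partial_load A xtil t))
      (ytil t) (xtil t).

Definition is_norm (R : realType) (n : nat) (N : 'cV[R]_n -> R) : Prop :=
  [/\ (forall u v, N (u + v) <= N u + N v),
      (forall (c : R) u, N (c *: u) = `|c| * N u) &
      (forall u, N u = 0 -> u = 0)].

Definition dual_norm (R : realType) (n : nat) (N : 'cV[R]_n -> R)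
    (y : 'cV[R]_n) : \bar R :=
  ereal_sup [set (dot y u)%:E | u in [set u | N u <= 1]].

(* psi lives on the closed set K, so at boundary points (in particular at the
   starting point 0) differentiability is relative to K; as K has nonempty
   interior, g is uniquely determined on K.  At a boundary point u the set
   superdiff K psi u is larger than {g u} (it is g u plus a nonzero cone), so
   that the algorithm follows the gradient has to be said separately. *)
Definition is_gradient_on (R : realType) (n : nat) (K : set 'cV[R]_n)
    (psi : 'cV[R]_n -> R) (g : 'cV[R]_n -> 'cV[R]_n) : Prop :=
  forall u, K u -> forall e : R, 0 < e ->
    \forall u' \near within K (nbhs u),
      `|psi u' - psi u - dot (g u) (u' - u)| <= e * `|u' - u|.

Definition lipschitz_gradient_on (R : realType) (n : nat) (K : set 'cV[R]_n)
    (N : 'cV[R]_n -> R) (mu : R) (g : 'cV[R]_n -> 'cV[R]_n) : Prop :=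
  forall u u', K u -> K u' ->
    (dual_norm N (g u' - g u) <= (mu^-1 * N (u - u'))%:E)%E.

(* Main.v *)
Require Import Defs.
From HB Require Import structures.
From mathcomp Require Import all_boot all_order all_algebra.
From mathcomp Require Import boolp classical_sets functions interval_inference.
From mathcomp Require Import reals ereal topology normedtype convex.
From mathcomp Require Import ring lra.

(** Let [u_t] be the load after [t] steps. In the order of the dual cone,
    Assumption 1 puts the least element [y] of the superdifferential at [u_m]
    below every dual variable [y_t] used on the way, and the [A_t x] lie in
    [K]; hence the support terms of the dual objective at [y] are at most
    [<A_t x_t, y_t>], and [D* <= \sum_t <A_t x_t, y_t> - psi^*(y)]. For the
    simultaneous update [y_t] is a supergradient at [u_(t+1)], so the sum
    telescopes to at most [psi u_m]; for the sequential update the same holds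
    with [y_(t+1)], which leaves the stated error term. It remains to use
    [psi^*(y) >= alpha_bar * psi u_m]. In the smooth case the error is bounded
    by the descent inequality, proved from concavity alone by cutting the
    segment from [u_t] to [u_(t+1)] into [p] equal pieces and letting [p] tend
    to infinity. *)

Import Order.TTheory GRing.Theory Num.Theory.
Import numFieldNormedType.Exports.

Local Open Scope classical_set_scope.
Local Open Scope ring_scope.

(** * Bilinearity of the pairing, and the dual norm inequality *)

Section Dot.
Context {R : realType}.

Lemma dotC {n} (u v : 'cV[R]_n) : dot u v = dot v u.
Proof. by apply: eq_bigr => i _; rewrite mulrC. Qed.

Lemma dotDr {n} (u v w : 'cV[R]_n) : dot u (v + w) = dot u v + dot u w.
Proof. by rewrite -big_split; apply: eq_bigr => i _; rewrite mxE mulrDr. Qed.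

Lemma dotZr {n} (c : R) (u v : 'cV[R]_n) : dot u (c *: v) = c * dot u v.
Proof. by rewrite mulr_sumr; apply: eq_bigr => i _; rewrite mxE mulrCA. Qed.

Lemma dotNr {n} (u v : 'cV[R]_n) : dot u (- v) = - dot u v.
Proof. by rewrite -scaleN1r dotZr mulN1r. Qed.

Lemma dotBr {n} (u v w : 'cV[R]_n) : dot u (v - w) = dot u v - dot u w.
Proof. by rewrite dotDr dotNr. Qed.

Lemma dot0r {n} (u : 'cV[R]_n) : dot u 0 = 0.
Proof. by rewrite -(scale0r 0) dotZr mul0r. Qed.

Lemma dotBl {n} (u v w : 'cV[R]_n) : dot (u - v) w = dot u w - dot v w.
Proof. by rewrite dotC dotBr !(dotC w). Qed.

Lemma dot_trmx_mul {n k} (B : 'M[R]_(n, k)) (x : 'cV[R]_k) (y : 'cV[R]_n) :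
  dot x (B^T *m y) = dot y (B *m x).
Proof.
rewrite /dot; under eq_bigr do rewrite mxE mulr_sumr.
rewrite exchange_big /=; apply: eq_bigr => i _.
by rewrite mxE mulr_sumr; apply: eq_bigr => j _; rewrite mxE; ring.
Qed.

(** Scale [h] to norm one and test the supremum there; [N] is nonnegative by subadditivity at [u]
    and [- u]. *)
Lemma dot_le_dual_norm {n} (N : 'cV[R]_n -> R) (y h : 'cV[R]_n) (c : R) :
  is_norm N -> (dual_norm N y <= c%:E)%E -> dot y h <= c * N h.
Proof.
move=> [ND NZ N0] yc.
have N00 : N 0 = 0 by rewrite -(scale0r 0) NZ normr0 mul0r.
have Nge0 u : 0 <= N u.
  have := ND u (- u); rewrite subrr N00 -scaleN1r NZ normrN1 mul1r => ?; lra.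
have [/N0 ->|Nh] := eqVneq (N h) 0; first by rewrite dot0r N00 mulr0.
have Nh0 : 0 < N h by rewrite lt0r Nh Nge0.
rewrite -ler_pdivrMr// mulrC -dotZr -lee_fin; apply: le_trans yc.
apply: ereal_sup_ubound; exists ((N h)^-1 *: h) => //=.
by rewrite NZ ger0_norm ?invr_ge0// mulVf.
Qed.

End Dot.

(** * Sums in a convex cone *)

Section Cone.
Context {R : realType} {n : nat} {K : set 'cV[R]_n}.
Hypothesis K_proper : proper_cone K.

Lemma cone0 : K 0.
Proof. by case: K_proper => [[]]. Qed.

Lemma coneZ (c : R) u : 0 <= c -> K u -> K (c *: u).
Proof. by case: K_proper => [[_ +]] _ _ _ _; apply. Qed.

Lemma coneD u v : K u -> K v -> K (u + v).
Proof.
move=> Ku Kv.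
have half01 : 0 <= (2^-1 : R) <= 1 by lra.
have [_ /(_ u v (Itv01 (proj1 (andP half01)) (proj2 (andP half01)))) Kconv _ _ _] := K_proper.
have /set_mem Kuv := Kconv (mem_set Ku) (mem_set Kv).
(* The sum is twice the midpoint, which convexity puts in [K]. *)
have -> : u + v = 2 *: (2^-1 *: u + (1 - 2^-1) *: v).
  rewrite scalerDr !scalerA mulfV// mulrBr mulfV// scale1r.
  by rewrite mulr1 (_ : 2 - 1 = 1 :> R) ?scale1r//; ring.
exact: coneZ.
Qed.

Lemma cone_sum (I : finType) (P : pred I) (f : I -> 'cV[R]_n) :
  (forall i, K (f i)) -> K (\sum_(i | P i) f i).
Proof. by move=> Kf; apply: (big_ind K) => //; [exact: cone0 | exact: coneD]. Qed.

End Cone.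

(** * Supergradients, conjugates and the constant [alpha_bar] *)

Section Competitive.
Context {R : realType} {n : nat} {K : set 'cV[R]_n} {psi : 'cV[R]_n -> R}.
Hypotheses (K_proper : proper_cone K)
  (psi_nondecreasing : nondecreasing_on K psi) (psi0 : psi 0 = 0)
  (superdiff_nonempty : forall u, K u -> superdiff K psi u !=set0).
Implicit Types u v y z : 'cV[R]_n.

Lemma extE u : K u -> ext K psi u = (psi u)%:E.
Proof. by move=> Ku; rewrite /ext mem_set. Qed.

Lemma ext_out u : ~ K u -> ext K psi u = -oo%E.
Proof. by move=> nKu; rewrite /ext memNset. Qed.

Lemma superdiffP u y : K u ->
  superdiff K psi u y <-> forall v, K v -> psi v <= dot y (v - u) + psi u.
Proof.
move=> Ku; split=> [yu v Kv|H v].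
  by have := yu v; rewrite !extE// -EFinD lee_fin.
have [Kv|/ext_out ->] := pselect (K v); last by rewrite leNye.
by rewrite !extE// -EFinD lee_fin H.
Qed.

Lemma conjugate_le u y : K u -> (conjugate K psi y <= (dot y u - psi u)%:E)%E.
Proof.
by move=> Ku; apply: ereal_inf_lbound; exists u => //; rewrite extE// EFinB.
Qed.

(** Equality case of Fenchel-Young: for a supergradient at [u], the infimum defining the conjugate
    is attained at [u]. *)
Lemma conjugateE u y : K u -> superdiff K psi u y ->
  conjugate K psi y = (dot y u - psi u)%:E.
Proof.
move=> Ku /(superdiffP _ _ Ku) yu.
apply/eqP; rewrite eq_le conjugate_le//=.
apply: le_ereal_inf_tmp => _ [v _ <-].
have [Kv|/ext_out ->] := pselect (K v); last by rewrite leey.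
rewrite extE// -EFinB lee_fin.
by have := yu v Kv; rewrite dotBr => ?; lra.
Qed.

(** Converse of the equality case; it extracts supergradients from saddle points. *)
Lemma superdiff_conjugate u y : K u ->
  ((dot y u)%:E - conjugate K psi y <= (psi u)%:E)%E -> superdiff K psi u y.
Proof.
move=> Ku yu; apply/superdiffP => // v Kv; move: yu (conjugate_le _ y Kv).
case: (conjugate K psi y) => [c| |]//.
by rewrite -EFinB !lee_fin dotBr => ? ?; lra.
Qed.

Lemma psi_ge0 u : K u -> 0 <= psi u.
Proof.
by move=> Ku; rewrite -psi0 psi_nondecreasing// ?/cone_le ?subr0//; exact: cone0.
Qed.

(** Moving from [u] by [v] in [K] cannot lower [psi], and raises it by at most [dot y v]. *)
Lemma superdiff_dual_cone u y : K u -> superdiff K psi u y -> dual_cone K y.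
Proof.
move=> Ku /(superdiffP _ _ Ku) yu v Kv.
have Kuv : K (u + v) by apply: (coneD K_proper).
have := yu _ Kuv; have := psi_nondecreasing _ _ Ku Kuv.
by rewrite /cone_le (addrC u) addrK => /(_ Kv) ? ?; lra.
Qed.

(** Every real [c] is admissible here: the condition reduces to [0 <= dot y u]. *)
Lemma alpha_of_psi_eq0 u : K u -> psi u = 0 -> alpha K psi u = +oo%E.
Proof.
move=> Ku u0; apply: eq_infty => c.
apply: ereal_sup_ubound; exists c => // y yu.
rewrite (conjugateE _ _ Ku yu) u0 mulr0 subr0 lee_fin.
exact: (superdiff_dual_cone _ _ Ku yu _ Ku).
Qed.

Lemma alpha_le u y (c : R) : K u -> superdiff K psi u y -> 0 < psi u ->
  conjugate K psi y = c%:E -> (alpha K psi u <= (c / psi u)%:E)%E.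
Proof.
move=> Ku yu u0 yc; apply: ge_ereal_sup => _ [d du <-].
by rewrite lee_fin ler_pdivlMr// -lee_fin -yc du.
Qed.

(** Testing the conjugate at the point 0 shows that it is at most 0, so [alpha] is at most 0
    wherever [psi] is positive. If [psi] vanishes on [K], then [alpha_bar] is not real. *)
Lemma alpha_bar_le0 (r : R) : alpha_bar K psi = r%:E -> r <= 0.
Proof.
move=> rE; rewrite -lee_fin -rE.
have [[u Ku u0]|H] := pselect (exists2 u, K u & psi u != 0).
  have [y yu] := superdiff_nonempty _ Ku.
  apply: le_trans (ereal_inf_lbound _) _; first by exists u.
  have up : 0 < psi u by rewrite lt0r u0 psi_ge0.
  apply: le_trans (alpha_le _ _ _ Ku yu up (conjugateE _ _ Ku yu)) _.
  have := conjugate_le _ y (cone0 K_proper).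
  rewrite (conjugateE _ _ Ku yu) dot0r psi0 subr0 !lee_fin => ?.
  by rewrite pmulr_lle0 ?invr_gt0.
suff : alpha_bar K psi = +oo%E by rewrite rE.
apply/eqP; rewrite eq_le leey/=; apply: le_ereal_inf_tmp => _ [u Ku <-].
rewrite alpha_of_psi_eq0//; apply: contrapT => /eqP u0.
by apply: H; exists u.
Qed.

Lemma alpha_bar_mul_le_conjugate (r : R) u y :
  alpha_bar K psi = r%:E -> K u -> superdiff K psi u y ->
  r * psi u <= dot y u - psi u.
Proof.
move=> rE Ku yu.
have [u0|u0] := eqVneq (psi u) 0.
  by rewrite u0 mulr0 subr0; exact: (superdiff_dual_cone _ _ Ku yu _ Ku).
have up : 0 < psi u by rewrite lt0r u0 psi_ge0.
rewrite -ler_pdivlMr// -lee_fin -rE.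
apply: le_trans (ereal_inf_lbound _) _; first by exists u.
exact: alpha_le (conjugateE _ _ Ku yu).
Qed.

Lemma inv_one_minus_alpha_bar_mul_le (D : \bar R) u y : K u ->
  superdiff K psi u y ->
  (D <= (psi u)%:E - conjugate K psi y)%E ->
  (inv_one_minus (alpha_bar K psi) * D <= (psi u)%:E)%E.
Proof.
move=> Ku yu; rewrite (conjugateE _ _ Ku yu) -EFinB => Dle.
(* For infinite [alpha_bar] the factor is 0 by convention, which leaves [psi u >= 0]. *)
case aE : (alpha_bar K psi) => [r| |] /=; rewrite ?mul0e ?lee_fin ?psi_ge0//.
have r0 := alpha_bar_le0 _ aE; have := alpha_bar_mul_le_conjugate _ _ _ aE Ku yu.
have r1 : 0 < 1 - r by lra.
move=> ?; have /(lee_wpmul2l _) H : (D <= ((1 - r) * psi u)%:E)%E.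
  by apply: le_trans Dle _; rewrite lee_fin; lra.
apply: le_trans (H ((1 - r)^-1)%:E _) _; first by rewrite lee_fin invr_ge0 ltW.
by rewrite -EFinM lee_fin mulKf// gt_eqF.
Qed.

(** * Loads along a run, and the bound common to both updates *)

Section Runs.
Context {k m : nat} {F : 'I_m -> set 'cV[R]_k} {A : 'I_m -> 'M[R]_(n, k)}.
Hypotheses (psi_assumption1 : assumption1 K psi)
  (AF_sub_K : forall t x, F t x -> K (A t *m x)).
Implicit Types x : 'I_m -> 'cV[R]_k.

Lemma partial_load0 x : partial_load A x 0 = 0.
Proof. by rewrite /partial_load big_pred0. Qed.

Lemma partial_load_full x : partial_load A x m = \sum_(t < m) A t *m x t.
Proof. by apply: eq_bigl => t; rewrite ltn_ord. Qed.

Lemma partial_loadS x (t : 'I_m) :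
  partial_load A x t.+1 = A t *m x t + partial_load A x t.
Proof.
rewrite /partial_load (bigD1 t)//=; congr (_ + _).
by apply: eq_bigl => s; rewrite ltnS (ltn_neqAle s t) andbC.
Qed.

Lemma partial_load_cone x (j : nat) :
  (forall t, F t (x t)) -> K (partial_load A x j).
Proof.
by move=> Fx; apply: (cone_sum K_proper) => t; apply: AF_sub_K.
Qed.

Lemma partial_load_le x (i j : nat) : (forall t, F t (x t)) -> (i <= j)%N ->
  cone_le K (partial_load A x i) (partial_load A x j).
Proof.
move=> Fx ij; rewrite /cone_le /partial_load [X in X - _](bigID (fun s : 'I_m => (s < i)%N))/=.
rewrite (eq_bigl (fun s : 'I_m => (s < i)%N)); last first.
  by move=> s /=; apply: andb_idl => si; exact: leq_trans ij.
rewrite addrAC subrr add0r.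
by apply: (cone_sum K_proper) => t; apply: AF_sub_K.
Qed.

Lemma telescope_partial_load x :
  \sum_(t < m) (psi (partial_load A x t.+1) - psi (partial_load A x t)) =
  psi (\sum_(t < m) A t *m x t).
Proof.
rewrite -(big_mkord xpredT (fun t => psi (partial_load A x t.+1) - psi (partial_load A x t))).
by rewrite telescope_sumr// partial_load_full partial_load0 psi0 subr0.
Qed.

(* The final dual variable [y] lies below every [y_t] in the order of the dual
   cone, so replacing [y_t] by [y] can only decrease the support terms. *)
Lemma dual_value_le x (yt : 'I_m -> 'cV[R]_n) (j : 'I_m -> nat) y :
  (forall t, F t (x t)) ->
  (forall t, (j t <= m)%N) ->
  (forall t, superdiff K psi (partial_load A x (j t)) (yt t)) ->
  (forall t a, F t a -> dot (yt t) (A t *m a) <= dot (yt t) (A t *m x t)) ->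
  superdiff K psi (\sum_(t < m) A t *m x t) y ->
  (forall z, superdiff K psi (\sum_(t < m) A t *m x t) z ->
     cone_le (dual_cone K) y z) ->
  (dual_value K psi F A <=
   (\sum_(t < m) dot (yt t) (A t *m x t))%:E - conjugate K psi y)%E.
Proof.
move=> Fx jm ytu xmax yu ymin.
apply: le_trans (ereal_inf_lbound _) _; first by exists y.
apply: leeB => //; rewrite -sumEFin; apply: lee_sum => t _.
apply: ge_ereal_sup => _ [a Fa <-].
rewrite lee_fin dot_trmx_mul; apply: le_trans (xmax _ _ Fa).
have Kj := partial_load_cone _ (j t) Fx; have Km := partial_load_cone _ m Fx.
(* Assumption 1 gives some supergradient [z] at the final load below [yt t]; minimality of [y] then
   gives [y] below [z]. *)
have [z zm zmin] := psi_assumption1 _ _ Km Kj (partial_load_le _ _ _ Fx (jm t)).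
rewrite partial_load_full in zm.
have := ymin _ zm _ (AF_sub_K _ _ Fa).
have := zmin _ (ytu t) _ (AF_sub_K _ _ Fa).
by rewrite !dotBl => ? ?; lra.
Qed.

(** Shared by both algorithms: [j t] indexes the load at which [yt t] is a supergradient, which is
    [t.+1] for the simultaneous and [t] for the sequential update; [e] is the error term. *)
Lemma run_competitive x (yt : 'I_m -> 'cV[R]_n) (j : 'I_m -> nat) y (e : R) :
  (forall t, F t (x t)) ->
  (forall t, (j t <= m)%N) ->
  (forall t, superdiff K psi (partial_load A x (j t)) (yt t)) ->
  (forall t a, F t a -> dot (yt t) (A t *m a) <= dot (yt t) (A t *m x t)) ->
  superdiff K psi (\sum_(t < m) A t *m x t) y ->
  (forall z, superdiff K psi (\sum_(t < m) A t *m x t) z ->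
     cone_le (dual_cone K) y z) ->
  \sum_(t < m) dot (yt t) (A t *m x t) + e <= psi (\sum_(t < m) A t *m x t) ->
  (inv_one_minus (alpha_bar K psi) * (dual_value K psi F A + e%:E)
   <= (psi (\sum_(t < m) A t *m x t)%R)%:E)%E.
Proof.
move=> Fx jm ytu xmax yu ymin e_le.
have Km := partial_load_cone _ m Fx; rewrite partial_load_full in Km.
apply: inv_one_minus_alpha_bar_mul_le (Km) (yu) _.
have := dual_value_le _ _ _ _ Fx jm ytu xmax yu ymin.
rewrite (conjugateE _ _ Km yu) -!EFinB => D_le.
by apply: le_trans (leeD2r _ D_le) _; rewrite -EFinD lee_fin; lra.
Qed.

(** The dual variable minimizes the saddle objective at the new load, and any supergradient [z]
    there attains the value [psi] of that load. *)
Lemma simultaneous_run_superdiff x (y : 'I_m -> 'cV[R]_n) (t : 'I_m) :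
  simultaneous_run K psi F A x y ->
  superdiff K psi (partial_load A x t.+1) (y t).
Proof.
move=> run; have Fx s : F s (x s) by case: (run s).
have Ku := partial_load_cone _ t.+1 Fx.
have [z zu] := superdiff_nonempty _ Ku.
apply: superdiff_conjugate => //; have [_ _ /(_ z)] := run t.
rewrite /saddle_objective -partial_loadS => /le_trans; apply.
by rewrite (conjugateE _ _ Ku zu) -EFinB lee_fin; lra.
Qed.

Lemma simultaneous_run_arg_max x (y : 'I_m -> 'cV[R]_n) (t : 'I_m) a :
  simultaneous_run K psi F A x y -> F t a ->
  dot (y t) (A t *m a) <= dot (y t) (A t *m x t).
Proof.
move=> run Fa; have Fx s : F s (x s) by case: (run s).
have yu := simultaneous_run_superdiff _ _ t run.
have Ku := partial_load_cone _ t.+1 Fx.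
have [_ /(_ _ Fa) + _] := run t.
(* The conjugate is finite at the supergradient [y t], so it cancels from both sides. *)
rewrite /saddle_objective (conjugateE _ _ Ku yu) -!EFinB lee_fin !dotDr => ?; lra.
Qed.

(* The supergradient inequality at the new point, applied to the old one. *)
Lemma superdiff_increment x y (t : 'I_m) : (forall t, F t (x t)) ->
  superdiff K psi (partial_load A x t.+1) y ->
  dot y (A t *m x t) <= psi (partial_load A x t.+1) - psi (partial_load A x t).
Proof.
move=> Fx.
move/(superdiffP _ _ (partial_load_cone _ t.+1 Fx))/(_ _ (partial_load_cone _ t Fx)).
rewrite [X in dot _ X](_ : _ = - (A t *m x t)) ?dotNr; first by move=> ?; lra.
by rewrite partial_loadS opprD addrCA subrr addr0.
Qed.

Lemma simultaneous_competitive x (y : 'I_m -> 'cV[R]_n) :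
  simultaneous_run K psi F A x y ->
  (inv_one_minus (alpha_bar K psi) * dual_value K psi F A
   <= (psi (\sum_(t < m) A t *m x t)%R)%:E)%E.
Proof.
move=> run; have Fx s : F s (x s) by case: (run s).
have yu t := simultaneous_run_superdiff _ _ t run.
have Km := partial_load_cone _ m Fx.
(* Assumption 1 with both points equal yields a least supergradient at the final load. *)
have [z zm zmin] := psi_assumption1 _ _ Km Km (partial_load_le _ _ _ Fx (leqnn m)).
rewrite partial_load_full in zm zmin.
rewrite -[dual_value _ _ _ _]adde0.
apply: (run_competitive _ y (fun t => t.+1) z 0 Fx) => //.
  by move=> t a; exact: simultaneous_run_arg_max.
rewrite addr0 -telescope_partial_load; apply: ler_sum => t _.
exact: superdiff_increment.
Qed.

(** * The sequential update *)

Section Sequential.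
Context {x : 'I_m -> 'cV[R]_k} {y : nat -> 'cV[R]_n}.
Hypothesis run : sequential_run K psi F A x y.

Lemma sequential_run_feasible t : F t (x t).
Proof. by case: run => _ /(_ t)[]. Qed.

Lemma sequential_run_superdiff (j : nat) : (j <= m)%N ->
  superdiff K psi (partial_load A x j) (y j).
Proof.
case: run => y0 _ yS _; case: j => [|j] jm; first by rewrite partial_load0.
exact: (yS (Ordinal jm)).
Qed.

Lemma sequential_run_competitive (e : R) :
  \sum_(t < m) dot (y t) (A t *m x t) + e <= psi (\sum_(t < m) A t *m x t) ->
  (inv_one_minus (alpha_bar K psi) * (dual_value K psi F A + e%:E)
   <= (psi (\sum_(t < m) A t *m x t)%R)%:E)%E.
Proof.
case: (run) => _ xmax _ ymin.
have ym := sequential_run_superdiff m (leqnn m); rewrite partial_load_full in ym ymin.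
apply: (run_competitive _ (fun t => y t) (fun t => t) (y m)) => //.
- exact: sequential_run_feasible.
- by move=> t; exact: ltnW.
- by move=> t; apply: sequential_run_superdiff; exact: ltnW.
by move=> t a Fa; have [_ /(_ _ Fa)] := xmax t; rewrite !dot_trmx_mul.
Qed.

Lemma sequential_competitive :
  (inv_one_minus (alpha_bar K psi) *
     (dual_value K psi F A +
      (\sum_(t < m) dot (A t *m x t) (y t.+1 - y t))%R%:E)
   <= (psi (\sum_(t < m) A t *m x t)%R)%:E)%E.
Proof.
apply: sequential_run_competitive.
rewrite -telescope_partial_load -big_split/=; apply: ler_sum => t _.
(* Adding the error term replaces [y t] by [y t.+1], a supergradient at the new load. *)
rewrite dotBr !(dotC (A t *m x t)) addrC subrK.
apply: superdiff_increment; first exact: sequential_run_feasible.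
exact: sequential_run_superdiff.
Qed.

End Sequential.
End Runs.
End Competitive.

(** * The descent inequality for a concave function with Lipschitz gradient *)

Section Gradient.
Context {R : realType} {n : nat} {K : set 'cV[R]_n} {psi : 'cV[R]_n -> R}.
Context {g : 'cV[R]_n -> 'cV[R]_n}.
Hypotheses (K_proper : proper_cone K) (psi_concave : concave_on K psi)
  (psi_gradient : is_gradient_on K psi g).

Lemma concave_on_segment (s : R) v w : 0 <= s -> s <= 1 -> K v -> K w ->
  K (v + s *: (w - v)) /\ psi v + s * (psi w - psi v) <= psi (v + s *: (w - v)).
Proof.
move=> s0 s1 Kv Kw.
have -> : v + s *: (w - v) = s *: w + (1 - s) *: v.
  by rewrite scalerBr scalerBl scale1r addrCA.
split; first by apply: (coneD K_proper); apply: (coneZ K_proper) => //; rewrite subr_ge0.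
have : - psi (s *: w + (1 - s) *: v) <= s * - psi w + (1 - s) * - psi v.
  exact: (psi_concave (Itv01 s0 s1) _ _ (mem_set Kw) (mem_set Kv)).
by move=> ?; lra.
Qed.

(** Compare concavity with the first-order expansion at a small parameter [s] on the segment, then
    divide by [s]. *)
Lemma gradient_superdiff v w : K v -> K w -> psi w <= dot (g v) (w - v) + psi v.
Proof.
move=> Kv Kw; apply/ler_addgt0Pr => e e0.
set z := w - v; pose d := e / (1 + `|z|).
have z0 : 0 < 1 + `|z| by rewrite ltr_pwDl.
have d0 : 0 < d by rewrite divr_gt0.
have /nbhs_ballP[r /= r0 rP] := psi_gradient _ Kv _ d0.
pose s := Num.min 1 (r / (1 + `|z|) / 2).
have s0 : 0 < s by rewrite lt_min ltr01 !divr_gt0.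
have s1 : s <= 1 by rewrite ge_min lexx.
have [Kp pP] := concave_on_segment _ _ _ (ltW s0) s1 Kv Kw.
have := rP (v + s *: z); rewrite -ball_normE /ball_ /= opprD addNKr normrN normrZ.
rewrite gtr0_norm//.
have sr : s * `|z| < r.
  have : s <= r / (1 + `|z|) / 2 by rewrite ge_min lexx orbT.
  rewrite ler_pdivlMr// ler_pdivlMr// => ?.
  by have := normr_ge0 z; nra.
move=> /(_ sr Kp); rewrite [v + s *: z - v]addrAC subrr add0r normrZ gtr0_norm// dotZr.
move=> /(le_trans (ler_norm _)) psi_le.
have dz : d * `|z| <= e.
  by rewrite /d mulrAC ler_pdivrMr// ler_pM2l// lerDr.
have : s * (psi w - psi v) <= s * (dot (g v) z + e).
  rewrite mulrDr; have : s * (d * `|z|) <= s * e by rewrite ler_pM2l.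
  by rewrite -/z in pP; lra.
by rewrite ler_pM2l// => ?; lra.
Qed.

(** Each piece uses the supergradient inequality at its far end, where the Lipschitz bound costs
    [s ^+ 2 * (j + 1) * c] for piece [j + 1]; these costs add up to the triangular number in the
    error. *)
Lemma descent_partition (N : 'cV[R]_n -> R) (mu : R) u h (p j : nat)
    (s := p.+1%:R^-1 : R) :
  is_norm N -> lipschitz_gradient_on K N mu g -> K u -> K h ->
  psi u + s * j%:R * dot (g u) h - s ^+ 2 * (j%:R * (j%:R + 1)) / 2 * (mu^-1 * N h ^+ 2)
  <= psi (u + (s * j%:R) *: h).
Proof.
move=> N_norm g_lip Ku Kh.
have s0 : 0 <= s by rewrite invr_ge0.
have Kv (i : nat) : K (u + (s * i%:R) *: h).
  by apply: (coneD K_proper) => //; apply: (coneZ K_proper) => //; rewrite mulr_ge0.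
elim: j => [|j IH]; first by rewrite !(mulr0, mul0r, scale0r, addr0, subr0).
set c := mu^-1 * N h ^+ 2 in IH *.
have := gradient_superdiff _ _ (Kv j.+1) (Kv j).
rewrite [X in dot _ X](_ : _ = (- s) *: h) ?dotZr -?(natr1 j); last first.
  by rewrite opprD addrACA subrr add0r -scalerBl; congr (_ *: _); ring.
have := g_lip _ _ (Kv j.+1) Ku => /(dot_le_dual_norm _ _ h _ N_norm).
have [_ NZ _] := N_norm.
rewrite addrAC subrr add0r NZ dotBl ger0_norm ?mulr_ge0// -(natr1 j).
rewrite [X in _ <= X](_ : _ = s * (j%:R + 1) * c); last by rewrite /c; ring.
move=> /(ler_wpM2l s0).
set X := dot (g (_ + _)) h; set Y := dot (g u) h in IH *.
set Z := psi (_ + _ *: h) in IH *.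
by clearbody X Y Z c s; lra.
Qed.

Lemma descent_lemma (N : 'cV[R]_n -> R) (mu : R) u h :
  is_norm N -> 0 < mu -> lipschitz_gradient_on K N mu g -> K u -> K h ->
  dot (g u) h <= psi (u + h) - psi u + (2 * mu)^-1 * N h ^+ 2.
Proof.
move=> N_norm mu0 g_lip Ku Kh.
pose c := mu^-1 * N h ^+ 2.
have c0 : 0 <= c by rewrite mulr_ge0 ?sqr_ge0// invr_ge0 ltW.
rewrite (_ : (2 * mu)^-1 * _ = c / 2); last by rewrite /c invfM; ring.
apply/ler_addgt0Pr => e e0.
(* With [p.+1] pieces the total error is [c / 2] plus this excess. *)
have [p pe] : exists p : nat, c / 2 / p.+1%:R <= e.
  exists (Num.truncn (e^-1 * (c / 2))).
  rewrite ler_pdivrMr// -ler_pdivrMl//.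
  exact: ltW (truncnS_gt _).
have := descent_partition _ _ u h p p.+1 N_norm g_lip Ku Kh.
rewrite /= mulVf// scale1r mul1r -/c.
have : p.+1%:R != 0 :> R by rewrite pnatr_eq0.
move: pe; set q := p.+1%:R => pe q0.
rewrite (_ : _ ^+ 2 * _ / 2 * c = c / 2 + c / 2 / q); last by field.
by clearbody c q; move: (c / 2 / q) pe => w pe ?; lra.
Qed.

End Gradient.

Theorem theorem1 (R : realType) (n k m : nat)
    (K : set 'cV[R]_n) (psi : 'cV[R]_n -> R)
    (F : 'I_m -> set 'cV[R]_k) (A : 'I_m -> 'M[R]_(n, k))
    (K_proper : proper_cone K)
    (psi_usc : upper_semicontinuous (ext K psi))
    (psi_concave : concave_on K psi)
    (psi_nondecreasing : nondecreasing_on K psi)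
    (psi0 : psi 0 = 0)
    (superdiff_nonempty : forall u, K u -> superdiff K psi u !=set0)
    (psi_assumption1 : assumption1 K psi)
    (F_compact : forall t, compact (F t))
    (F_convex : forall t, convex_set (F t))
    (AF_sub_K : forall t x, F t x -> K (A t *m x)) :
  (forall (xtil : 'I_m -> 'cV[R]_k) (ytil : 'I_m -> 'cV[R]_n),
     simultaneous_run K psi F A xtil ytil ->
     (inv_one_minus (alpha_bar K psi) * dual_value K psi F A
      <= (psi (\sum_(t < m) A t *m xtil t)%R)%:E)%E) /\
  (forall (xhat : 'I_m -> 'cV[R]_k) (yhat : nat -> 'cV[R]_n),
     sequential_run K psi F A xhat yhat ->
     (inv_one_minus (alpha_bar K psi) *
        (dual_value K psi F A +
         (\sum_(t < m) dot (A t *m xhat t) (yhat t.+1 - yhat t))%R%:E)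
      <= (psi (\sum_(t < m) A t *m xhat t)%R)%:E)%E /\
     (forall (N : 'cV[R]_n -> R) (mu : R) (g : 'cV[R]_n -> 'cV[R]_n),
        is_norm N -> 0 < mu ->
        is_gradient_on K psi g -> lipschitz_gradient_on K N mu g ->
        (forall t : 'I_m, yhat t = g (partial_load A xhat t)) ->
        (inv_one_minus (alpha_bar K psi) *
           (dual_value K psi F A -
            (\sum_(t < m) (2 * mu)^-1 * N (A t *m xhat t) ^+ 2)%R%:E)
         <= (psi (\sum_(t < m) A t *m xhat t)%R)%:E)%E)).
Proof.
split=> [xtil ytil|xhat yhat run]; first exact: simultaneous_competitive.
split=> [|N mu g N_norm mu0 g_grad g_lip yg]; first exact: sequential_competitive.
(* The descent inequality is applied to [yhat t] itself, at the load before step [t], instead of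
   estimating the increments of [yhat] in the previous bound. *)
rewrite -EFinN; apply: sequential_run_competitive (run) _ _ => //.
have Fx := sequential_run_feasible run.
rewrite lerBlDr -(telescope_partial_load psi0) -big_split/=.
apply: ler_sum => t _; rewrite yg partial_loadS addrC.
have := descent_lemma K_proper psi_concave g_grad N mu (partial_load A xhat t)
  (A t *m xhat t) N_norm mu0 g_lip (partial_load_cone K_proper AF_sub_K _ _ Fx)
  (AF_sub_K _ _ (Fx t)).
by rewrite [A t *m _ + _]addrC => ?; lra.
Qed.
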